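(* Let $\eta:\mathcal{X}\to[0,1]$ be the true regression function, $\eta(x)=\mathbb{P}[Y=1\mid X=x]$, and let $\hat\eta:\mathcal{X}\to[0,1]$ be any regressor. Let $M$ be a confusion matrix measure (CMM), and let $$(\hat p,\hat t):=\operatorname*{arg\,max}_{(p,t)\in[0,1]^2}M\left(\hat C_{\hat Y_{p,t,\hat\eta}}\right),\qquad (p^*,t^* ):=\operatorname*{arg\,max}_{(p,t)\in[0,1]^2}M\left(C_{\hat Y_{p,t,\eta}}\right)$$ denote the empirical and true optimal thresholds, respectively. Suppose $M$ is Lipschitz continuous with constant $L_M$ with respect to the uniform metric on $\mathcal{C}$ (the metric induced by the entrywise maximum norm). Finally, suppose $P_X$ and $\eta$ satisfy a $(C,\beta)$-margin condition around $t^*$. Then, with probability at least $1-\delta$, $$M\left(C_{\hat Y_{p^*,t^*,\eta}}\right)-M\left(C_{\hat Y_{\hat p,\hat t,\hat\eta}}\right)\le L_M\left(C\,\|\eta-\hat\eta\|_\infty^\beta+2\sqrt{\frac{8}{n}\log\frac{32(2n+1)}{\delta}}\right).$$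
   Context: $(\mathcal{X},\rho)$ is a separable metric space; $(X_1,Y_1),\dots,(X_n,Y_n)$ are i.i.d. from a distribution $P_{X,Y}$ on $\mathcal{X}\times\{0,1\}$ with $X$-marginal $P_X$, and $(X,Y)\sim P_{X,Y}$; $\delta\in(0,1)$. A regressor is an estimate $\hat\eta:\mathcal{X}\to[0,1]$ of the true regression function $\eta$. All functions on $\mathcal{X}$ are measurable and $\|\eta-\hat\eta\|_\infty=\sup_{x\in\mathcal{X}}|\eta(x)-\hat\eta(x)|$. For $p,t\in[0,1]$ and $g:\mathcal{X}\to[0,1]$, the regression-thresholding classifier $\hat Y_{p,t,g}$ is the stochastic classifier with $\hat Y_{p,t,g}(x)\sim\mathrm{Bernoulli}(f_{p,t,g}(x))$, where $f_{p,t,g}(x)=p\cdot1\{g(x)=t\}+1\{g(x)>t\}$. The classifiers' randomness on the sample is realized through $Z_1,\dots,Z_n$ i.i.d. uniform on $[0,1]$, independent of the data, by $\hat Y_{p,t,g}(X_i)=1\{Z_i<f_{p,t,g}(X_i)\}$ simultaneously for all $p,t$. $\mathcal{C}=\{C\in[0,1]^{2\times2}:\sum_{i,j}C_{i,j}=1\}$. The true confusion matrix of a classifier $\hat Y$ is $C_{\hat Y}=\begin{bmatrix}\mathrm{TN}&\mathrm{FP}\\ \mathrm{FN}&\mathrm{TP}\end{bmatrix}$ with $\mathrm{TP}=\mathbb{E}[\eta(X)\hat Y(X)]$, $\mathrm{FN}=\mathbb{E}[\eta(X)(1-\hat Y(X))]$, $\mathrm{FP}=\mathbb{E}[(1-\eta(X))\hat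 Y(X)]$, $\mathrm{TN}=\mathbb{E}[(1-\eta(X))(1-\hat Y(X))]$, where $\eta$ is the true regression function. The empirical confusion matrix $\hat C_{\hat Y}$ has the same layout with entries $\widehat{\mathrm{TP}}=\frac1n\sum_iY_i\hat Y(X_i)$, $\widehat{\mathrm{FN}}=\frac1n\sum_iY_i(1-\hat Y(X_i))$, $\widehat{\mathrm{FP}}=\frac1n\sum_i(1-Y_i)\hat Y(X_i)$, $\widehat{\mathrm{TN}}=\frac1n\sum_i(1-Y_i)(1-\hat Y(X_i))$. The confusion matrix $C_{\hat Y_{\hat p,\hat t,\hat\eta}}$ is $C_{\hat Y_{p,t,g}}$ evaluated at $(p,t,g)=(\hat p,\hat t,\hat\eta)$. A function $M:\mathcal{C}\to\mathbb{R}$ is a confusion matrix measure (CMM) if for every $\begin{bmatrix}\mathrm{TN}&\mathrm{FP}\\ \mathrm{FN}&\mathrm{TP}\end{bmatrix}\in\mathcal{C}$, $\epsilon_1\in[0,\mathrm{FP}]$, $\epsilon_2\in[0,\mathrm{FN}]$, one has $M\left(\begin{bmatrix}\mathrm{TN}&\mathrm{FP}\\ \mathrm{FN}&\mathrm{TP}\end{bmatrix}\right)\le M\left(\begin{bmatrix}\mathrm{TN}+\epsilon_1&\mathrm{FP}-\epsilon_1\\ \mathrm{FN}-\epsilon_2&\mathrm{TP}+\epsilon_2\end{bmatrix}\right)$. Margin condition: for $C,\beta\ge0$ and $t\in(0,1)$, $P_X$ and $\eta$ satisfy a $(C,\beta)$-margin condition around $t$ if $\mathbb{P}[|\eta(X)-t|\le\epsilon]\le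 C\epsilon^\beta$ for every $\epsilon>0$. The argmax notation means that maximizers exist and $(\hat p,\hat t)$, $(p^*,t^* )$ are chosen maximizers. *)

(* Defs.v *)
From HB Require Import structures.
From mathcomp Require Import all_boot all_order all_algebra.
From mathcomp Require Import all_classical all_reals all_analysis.

Set Implicit Arguments.
Unset Strict Implicit.
Unset Printing Implicit Defensive.

Import Order.TTheory GRing.Theory Num.Theory.
Import numFieldNormedType.Exports.

Local Open Scope classical_set_scope.
Local Open Scope ring_scope.

(* The library's g_sigma_algebraType needs a pointed carrier; this costs no
   generality, since a space carrying a probability is nonempty. *)
#[short(type="pmetricType")]
HB.structure Definition PMetric (K : numDomainType) :=
  { M of Metric K M & isPointed M }.

Definition separable (T : topologicalType) : Prop :=
  exists2 D : set T, countable D & dense D.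

Notation borel X := (g_sigma_algebraType (@open X)).

HB.instance Definition _ d1 d2 (T1 : measurableType d1)
    (T2 : measurableType d2) :=
  isMeasurableFun.Build _ _ (T1 * T2)%type T1 fst measurable_fst.

Section independence.
Context d (Omega : measurableType d) (R : realType) (P : probability Omega R).

Definition mutually_independent (I : finType) (F : I -> set (set Omega)) :=
  forall (J : {set I}) (E : I -> set Omega),
    (forall i, i \in J -> F i (E i)) ->
    P (\bigcap_(i in [set` J]) E i) = (\prod_(i in J) P (E i))%E.

Definition sigma_rv d' (T : measurableType d') (X : Omega -> T) :
    set (set Omega) :=
  preimage_set_system setT X measurable.

Definition sigma_family d' (T : measurableType d') (I : Type)
    (X : I -> Omega -> T) : set (set Omega) :=
  <<s \bigcup_(i in [set: I]) sigma_rv (X i) >>.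

(* mu is a mere set function, so that it may be declared on a measurable type
   that differs from T only by its display, such as uniform_prob on R. *)
Definition iid d' (T : measurableType d') (I : finType)
    (X : I -> {RV P >-> T}) (mu : set T -> \bar R) :=
  mutually_independent (fun i => sigma_rv (X i)) /\
  forall i A, measurable A -> distribution P (X i) A = mu A.

Definition independent_families d1 d2 (T1 : measurableType d1)
    (T2 : measurableType d2) (I1 I2 : Type)
    (X : I1 -> {RV P >-> T1}) (Z : I2 -> {RV P >-> T2}) :=
  forall A B, sigma_family (fun i => X i : Omega -> T1) A ->
    sigma_family (fun i => Z i : Omega -> T2) B ->
    P (A `&` B) = (P A * P B)%E.

(* Inner probability: E contains a measurable event of probability >= q; this
   is P E >= q whenever E is measurable. *)
Definition with_probability_at_least (q : R) (E : set Omega) :=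
  exists A : set Omega, [/\ measurable A, A `<=` E & (q%:E <= P A)%E].

End independence.

Definition argmax_on (T : Type) (R : realType) (D : set T) (F : T -> R)
    (a : T) :=
  D a /\ forall b, D b -> F b <= F a.

Section confusion_matrices.
Context (R : realType).

Definition mk_confusion (tn fp fn tp : R) : 'M[R]_2 :=
  \matrix_(i, j) if i == 0 then (if j == 0 then tn else fp)
                 else (if j == 0 then fn else tp).

Definition confusion_space : set 'M[R]_2 :=
  [set C | (forall i j, 0 <= C i j <= 1) /\ \sum_i \sum_j C i j = 1].

(* A function on confusion_space is given by a total function on 2 x 2 matrices
   that is constrained, and evaluated, on confusion_space only. *)
Definition cmm (M : 'M[R]_2 -> R) :=
  forall tn fp fn tp e1 e2 : R,
    confusion_space (mk_confusion tn fp fn tp) ->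
    0 <= e1 <= fp -> 0 <= e2 <= fn ->
    M (mk_confusion tn fp fn tp) <=
    M (mk_confusion (tn + e1) (fp - e1) (fn - e2) (tp + e2)).

Definition empirical_confusion (n : nat) (y yhat : 'I_n -> bool) : 'M[R]_2 :=
  mk_confusion
    (n%:R^-1 * \sum_(i < n) (1 - (y i)%:R) * (1 - (yhat i)%:R))
    (n%:R^-1 * \sum_(i < n) (1 - (y i)%:R) * (yhat i)%:R)
    (n%:R^-1 * \sum_(i < n) (y i)%:R * (1 - (yhat i)%:R))
    (n%:R^-1 * \sum_(i < n) (y i)%:R * (yhat i)%:R).

End confusion_matrices.

Section classification.
Context (R : realType) d (T : measurableType d).
Implicit Types (PX : probability T R) (PXY : probability (T * bool)%type R).
Implicit Types (eta g : T -> R) (p t : R).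

Definition regressor g :=
  measurable_fun setT g /\ forall x, 0 <= g x <= 1.

Definition marginal PXY : probability T R := distribution PXY fst.

Definition regression_function PXY eta :=
  regressor eta /\
  forall A, measurable A ->
    PXY (A `*` [set true]) = (\int[marginal PXY]_(x in A) (eta x)%:E)%E.

Definition sup_dist eta g : R := sup (range (fun x => `|eta x - g x|)).

Definition rt_prob p t g (x : T) : R := p * (g x == t)%:R + (t < g x)%R%:R.

(* A stochastic classifier is represented by the laws of its predictions. *)
Definition rt_classifier p t g (x : T) : probability bool R :=
  bernoulli_prob (rt_prob p t g x).

(* Realization at x of the Bernoulli prediction, z being uniform on [0, 1]. *)
Definition rt_predict p t g (x : T) (z : R) : bool := z < rt_prob p t g x.

Definition true_confusion PX eta (K : T -> probability bool R) : 'M[R]_2 :=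
  mk_confusion
    (\int[PX]_x \int[K x]_y ((1 - eta x) * (1 - (y : bool)%:R)))
    (\int[PX]_x \int[K x]_y ((1 - eta x) * (y : bool)%:R))
    (\int[PX]_x \int[K x]_y (eta x * (1 - (y : bool)%:R)))
    (\int[PX]_x \int[K x]_y (eta x * (y : bool)%:R)).

Definition margin_condition PX eta (C beta t : R) :=
  [/\ 0 <= C, 0 <= beta, 0 < t < 1 &
    forall eps, 0 < eps ->
      (PX [set x | `|eta x - t| <= eps]%R <= (C * eps `^ beta)%:E)%E].

Definition unit_square : set (R * R) :=
  [set pt | 0 <= pt.1 <= 1 /\ 0 <= pt.2 <= 1].

End classification.

(* Main.v *)
Require Import Defs.
From HB Require Import structures.
From mathcomp Require Import all_boot all_order all_algebra.
From mathcomp Require Import all_classical all_reals all_analysis.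
From mathcomp Require Import measurable_realfun.
From mathcomp Require Import ring lra.

Import Order.TTheory GRing.Theory Num.Theory.
Import numFieldNormedType.Exports.

Local Open Scope classical_set_scope.
Local Open Scope ring_scope.

(** The excess risk M(C_star) - M(C_hat) telescopes through three intermediate
    matrices: the true matrix of the classifier (pstar, tstar, etahat), its
    empirical matrix, and the empirical matrix of (phat, that, etahat).  The
    passage from one empirical matrix to the other does not lose anything, by
    the choice of (phat, that).  The other three steps cost L times the distance
    of two matrices: replacing eta by etahat at a fixed threshold is controlled
    by the margin condition (margin_confusion_entry), and the two passages
    between true and empirical matrices by a deviation bound that is uniform
    over all thresholds (uniform_deviation).

    Instead of a Vapnik-Chervonenkis argument, the uniform bound rests on the
    fact that the randomized thresholdings of a fixed g form a chain: f_(p,t) is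
    pointwise monotone in (p, t) for the lexicographic order (rt_prob_total).
    Because p interpolates through the atoms of g, the mean of f_(p,t) takes
    every value in [0, 1] (exists_rt_prob_mean), so there is a grid of n + 1
    thresholds with means 0, 1/n, ..., 1, and every f_(p,t) lies between two
    consecutive grid functions.  The entries of both confusion matrices are
    monotone in f, so a deviation of at most u on the grid becomes one of at
    most u + 1/n everywhere (bracketed_deviation).

    On the grid, a union bound over 8(n + 1) one-sided tails is enough
    (grid_deviation).  One tail is a Chernoff bound for a count of n independent
    cells in a finite set (chernoff_finfun, iid_cells_tail): at a fixed
    threshold the prediction at X_i depends only on the position of g(X_i) with
    respect to t and on that of Z_i with respect to 0, p and 1.  With u half of
    the target deviation, each tail is at most delta / (32(2n + 1)), and 1/n
    fits in the other half. *)

(** * A Chernoff bound on finite product spaces *)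

(** Inverting exp(-x) >= 1 - x gives exp x <= 1 / (1 - x), and
    (1 - x)(1 + x + 2x^2) = 1 + x^2 (1 - 2x) >= 1. *)
Lemma expR_le_quadratic {R : realType} (x : R) :
  x <= 2^-1 -> expR x <= 1 + x + 2 * x ^+ 2.
Proof.
move=> x2; have e1 := expR_ge1Dx (- x).
have x1 : 0 < 1 - x by lra.
have e0 := expR_gt0 (- x).
rewrite -[x in expR x]opprK expRN; apply: (@le_trans _ _ (1 - x)^-1).
  by rewrite lef_pV2 ?posrE.
rewrite -[_^-1]mul1r ler_pdivrMr//.
have : 0 <= x ^+ 2 * (1 - 2 * x) by rewrite mulr_ge0 ?sqr_ge0//; lra.
by rewrite !expr2; lra.
Qed.

(** The upper tail of the number of successes of h in n independent draws from
    q.  The indicator of the tail is at most exp(u (S - n(p + u))), with S the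
    number of successes and p the probability of one; the sum over all draws
    then factorizes, and each factor is at most
    exp(-u^2) (1 + 2 u^2 p (1 - p)) <= exp(-u^2 / 2).  Using the deviation u
    itself as exponential parameter weakens the constant of Hoeffding's
    inequality, but the elementary bound on exp is then sufficient. *)
Lemma chernoff_finfun {R : realType} {K : finType} (q : K -> R) (h : pred K)
    (n : nat) (u : R) :
  (forall k, 0 <= q k) -> \sum_k q k = 1 -> 0 <= u <= 2^-1 ->
  \sum_(f : {ffun 'I_n -> K}
      | n%:R * (\sum_(k | h k) q k + u) < \sum_i (h (f i))%:R)
    \prod_i q (f i) <= expR (- (n%:R * u ^+ 2 / 2)).
Proof.
move=> q0 q1 /andP[u0 u2]; set p := \sum_(k | h k) q k.
have p0 : 0 <= p by exact: sumr_ge0.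
have pE : p = \sum_k q k * (h k)%:R.
  by rewrite /p big_mkcond; apply: eq_bigr => k _; case: (h k);
    rewrite ?mulr1 ?mulr0.
have p1 : p <= 1.
  rewrite -q1 pE; apply: ler_sum => k _.
  by rewrite -[leRHS]mulr1 ler_wpM2l// lern1; case: (h k).
pose e k : R := expR (u * ((h k)%:R - p - u)).
apply: (@le_trans _ _ (\sum_(f : {ffun 'I_n -> K}) \prod_i (q (f i) * e (f i)))).
  rewrite big_mkcond; apply: ler_sum => f _.
  rewrite big_split /=; have qf0 : 0 <= \prod_i q (f i) by exact: prodr_ge0.
  have ef0 : 0 <= \prod_i e (f i) by apply: prodr_ge0 => i _; exact: expR_ge0.
  case: ifPn => [fP|_]; last exact: mulr_ge0.
  rewrite -[leLHS]mulr1 ler_wpM2l//.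
  rewrite /e -expR_sum -[leLHS]expR0 ler_expR -mulr_sumr mulr_ge0//.
  have -> : \sum_i ((h (f i))%:R - p - u) =
      \sum_i (h (f i))%:R - n%:R * (p + u) :> R.
    by rewrite -[n in n%:R]card_ord mulr_natl -sumr_const -sumrB;
      apply: eq_bigr => i _; rewrite opprD addrA.
  by rewrite subr_ge0 ltW.
rewrite -(bigA_distr_bigA (fun (i : 'I_n) k => q k * e k)) prodr_const card_ord.
have -> : - (n%:R * u ^+ 2 / 2) = n%:R * - (u ^+ 2 / 2).
  by ring.
rewrite expRM_natl; apply: lerXn2r; rewrite ?nnegrE ?expR_ge0//.
  by apply: sumr_ge0 => k _; rewrite mulr_ge0// expR_ge0.
(* The quadratic bound at u (h k - p), written as an affine function of h k
   because h k is its own square. *)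
apply: (@le_trans _ _ (\sum_k expR (- u ^+ 2) *
    (q k * (1 + 2 * (u * p) ^+ 2 - u * p) +
     q k * (h k)%:R * (u + 2 * u ^+ 2 * (1 - 2 * p))))).
  apply: ler_sum => k _.
  have -> : e k = expR (- u ^+ 2) * expR (u * ((h k)%:R - p)).
    by rewrite -expRD; congr expR; ring.
  rewrite mulrCA ler_wpM2l ?expR_ge0//.
  have /expR_le_quadratic : u * ((h k)%:R - p) <= 2^-1.
    have : (h k)%:R <= 1 :> R by rewrite lern1; case: (h k).
    move=> h1; have : u * ((h k)%:R - p) <= u * 1 by rewrite ler_wpM2l//; lra.
    by rewrite mulr1; move=> /le_trans; apply.
  move=> /(ler_wpM2l (q0 k)) /le_trans; apply.
  by rewrite le_eqVlt; apply/orP; left; apply/eqP; case: (h k) => /=; ring.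
rewrite -mulr_sumr big_split /= -!mulr_suml q1 -pE.
have -> : - (u ^+ 2 / 2) = - u ^+ 2 + u ^+ 2 / 2 by field.
rewrite expRD ler_wpM2l ?expR_ge0//.
apply: le_trans (expR_ge1Dx _).
have : 0 <= (u * (2 * p - 1)) ^+ 2 by exact: sqr_ge0.
by rewrite !expr2; lra.
Qed.

(** * Independent samples seen through finitely many cells *)

Lemma fine_measure_fibers {R : realType} {d} {T : measurableType d}
    (mu : probability T R) {K : finType} (c : T -> K) :
  (forall k, measurable (c @^-1` [set k])) ->
  forall h : pred K, measurable [set t | h (c t)] /\
    fine (mu [set t | h (c t)]) = \sum_(k | h k) fine (mu (c @^-1` [set k])).
Proof.
move=> mc h.
have hE : [set t | h (c t)] = \bigcup_(k in [set k | h k]) c @^-1` [set k].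
  by apply/seteqP; split => [t ht|t [k hk /= ->]//]; exists (c t).
have mh : measurable [set t | h (c t)].
  by rewrite hE; apply: fin_bigcup_measurable => //; exact: finite_finset.
split=> //; rewrite hE measure_fin_bigcup//.
- have -> : [set k | h k] = [set` enum h].
    by apply/seteqP; split => k /=; rewrite mem_enum.
  rewrite -fsbig_seq ?enum_uniq// big_enum /= -sum_fine//.
  by move=> k _; rewrite fin_num_measure.
- exact: finite_finset.
- by move=> i j _ _ [t [/= <- <-]].
Qed.

(** Independence inside each of the two samples and independence between the
    samples combine into a single product rule for rectangles: the two
    intersections belong to the sigma-algebras generated by the samples. *)
Lemma independent_cells {R : realType} {d} {Omega : measurableType d}
    (P : probability Omega R) {d1 d2} {T1 : measurableType d1}
    {T2 : measurableType d2} (n : nat)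
    (W : 'I_n -> {RV P >-> T1}) (Z : 'I_n -> {RV P >-> T2})
    (mu : set T1 -> \bar R) (nu : set T2 -> \bar R)
    (A : 'I_n -> set T1) (B : 'I_n -> set T2) :
  (0 < n)%N -> iid W mu -> iid Z nu -> independent_families W Z ->
  (forall i, measurable (A i)) -> (forall i, measurable (B i)) ->
  P (\bigcap_i (W i @^-1` A i `&` Z i @^-1` B i)) =
    (\prod_i (mu (A i) * nu (B i)))%E.
Proof.
case: n W Z A B => // n W Z A B _ [indW lawW] [indZ lawZ] indWZ mA mB.
have inG d' (T : measurableType d') (X : 'I_n.+1 -> {RV P >-> T})
    (E : 'I_n.+1 -> set T) : (forall i, measurable (E i)) ->
    sigma_family (fun i => X i : Omega -> T) (\bigcap_i (X i @^-1` E i)).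
  move=> mE; rewrite /sigma_family; set G := \bigcup_(i in _) _.
  have [_ _ _ IG] : [/\ <<s G >> setT, setSD_closed <<s G >>,
      ndseq_closed <<s G >> & setI_closed <<s G >>].
    by apply/sigma_algebraP => //; exact: smallest_sigma_algebra.
  move/finN0_bigcap_closedP : IG; apply => //.
  - by exists ord0.
  - by move=> i _; apply: sub_sigma_algebra; exists i => //; exists (E i);
      rewrite ?setTI.
have prodE d' (T : measurableType d') (X : 'I_n.+1 -> {RV P >-> T})
    (E : 'I_n.+1 -> set T) : (forall i, measurable (E i)) ->
    mutually_independent P (fun i => sigma_rv (X i)) ->
    P (\bigcap_i (X i @^-1` E i)) = (\prod_i distribution P (X i) (E i))%E.
  move=> mE /(_ [set: 'I_n.+1]%SET (fun i => X i @^-1` E i)) ind.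
  have -> : \bigcap_i (X i @^-1` E i) =
      \bigcap_(i in [set` [set: 'I_n.+1]%SET]) (X i @^-1` E i).
    by congr bigcap; apply/seteqP; split => i //= _; rewrite finset.in_setT.
  rewrite ind; first by apply: eq_bigl => i; rewrite finset.in_setT.
  by move=> i _; exists (E i); rewrite ?setTI.
rewrite bigcapI (indWZ _ _ (inG _ _ W A mA) (inG _ _ Z B mB)).
rewrite !prodE// big_split /=.
by congr (_ * _)%E; apply: eq_bigr => i _; rewrite ?lawW ?lawZ.
Qed.

(** The law of a pair of cells whose coordinates are independent. *)
Definition cell_mass {R : realType} {d1 d2} {T1 : measurableType d1}
    {T2 : measurableType d2} (mu : probability T1 R) (nu : probability T2 R)
    {K1 K2 : finType} (a : T1 -> K1) (b : T2 -> K2) (k : K1 * K2) : R :=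
  fine (mu (a @^-1` [set k.1])) * fine (nu (b @^-1` [set k.2])).

Lemma cell_mass_sum1 {R : realType} {d1 d2} {T1 : measurableType d1}
    {T2 : measurableType d2} (mu : probability T1 R) (nu : probability T2 R)
    {K1 K2 : finType} (a : T1 -> K1) (b : T2 -> K2) :
  (forall k, measurable (a @^-1` [set k])) ->
  (forall k, measurable (b @^-1` [set k])) ->
  \sum_k cell_mass mu nu a b k = 1.
Proof.
move=> ma mb.
have total d (T : measurableType d) (K : finType) (rho : probability T R)
    (c : T -> K) : (forall k, measurable (c @^-1` [set k])) ->
    \sum_k fine (rho (c @^-1` [set k])) = 1.
  move=> mc; have [_ <-] := fine_measure_fibers rho c mc predT.
  by rewrite (_ : [set t | _] = setT) ?probability_setT//; apply/seteqP.
rewrite /cell_mass.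
rewrite -(pair_bigA _ (fun k1 k2 =>
  fine (mu (a @^-1` [set k1])) * fine (nu (b @^-1` [set k2])))) /=.
by under eq_bigr do rewrite -mulr_sumr (total _ _ _ nu)// mulr1; exact: total.
Qed.

(** Only the rectangles cut out by the finitely many cells enter h, so the
    counts of h have an exactly multiplicative finite law, to which
    chernoff_finfun applies. *)
Lemma iid_cells_tail {R : realType} {d} {Omega : measurableType d}
    (P : probability Omega R) {d1 d2} {T1 : measurableType d1}
    {T2 : measurableType d2} (n : nat)
    (W : 'I_n -> {RV P >-> T1}) (Z : 'I_n -> {RV P >-> T2})
    (mu : probability T1 R) (nu : probability T2 R)
    {K1 K2 : finType} (a : T1 -> K1) (b : T2 -> K2) (h : pred (K1 * K2))
    (u : R) :
  (0 < n)%N -> iid W mu -> iid Z nu -> independent_families W Z ->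
  (forall k, measurable (a @^-1` [set k])) ->
  (forall k, measurable (b @^-1` [set k])) ->
  0 <= u <= 2^-1 ->
  let E := [set w | n%:R * (\sum_(k | h k) cell_mass mu nu a b k + u) <
                    \sum_i (h (a (W i w), b (Z i w)))%:R] in
  measurable E /\ (P E <= (expR (- (n%:R * u ^+ 2 / 2)))%:E)%E.
Proof.
move=> n0 iW iZ iWZ ma mb u01 E.
pose q := cell_mass mu nu a b.
pose c w : {ffun 'I_n -> K1 * K2} := [ffun i => (a (W i w), b (Z i w))].
have cE f : c @^-1` [set f] = \bigcap_i (W i @^-1` (a @^-1` [set (f i).1]) `&`
    Z i @^-1` (b @^-1` [set (f i).2])).
  apply/seteqP; split => [w /= <- i _|w /= cw]; first by rewrite /= ffunE.
  apply/ffunP => i; rewrite ffunE; have [/= -> ->] := cw i I.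
  by rewrite -surjective_pairing.
have mc f : measurable (c @^-1` [set f]).
  rewrite cE; apply: fin_bigcap_measurable; first exact: finite_finset.
  by move=> i _; apply: measurableI; rewrite -[X in measurable X]setTI;
    exact: measurable_funP.
pose H (f : {ffun 'I_n -> K1 * K2}) :=
  n%:R * (\sum_(k | h k) q k + u) < \sum_i (h (f i))%:R.
have EH : E = [set w | H (c w)].
  apply/funext => w; rewrite /E /H /=; congr (is_true (_ < _)).
  by apply: eq_bigr => i _; rewrite ffunE.
have [mE PE] := fine_measure_fibers P c mc H.
rewrite EH; split => //; rewrite -[P _]fineK ?fin_num_measure// PE lee_fin.
have q0 k : 0 <= q k by rewrite mulr_ge0 ?fine_ge0.
have q1 : \sum_k q k = 1 by exact: cell_mass_sum1.
apply: le_trans (chernoff_finfun q h n u q0 q1 u01).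
apply: ler_sum => f _; rewrite cE (independent_cells P n W Z mu nu _ _ n0 iW iZ iWZ)//.
have mq i : (mu (a @^-1` [set (f i).1]) * nu (b @^-1` [set (f i).2]) =
    (q (f i))%:E)%E.
  by rewrite /q EFinM !fineK ?fin_num_measure.
by rewrite (eq_bigr _ (fun i _ => mq i)) prodEFin.
Qed.

(** * Prediction probabilities and confusion entries *)

Lemma rt_probE {R : realType} {d} {T : measurableType d} (p t : R)
    (g : T -> R) (x : T) :
  rt_prob p t g x = if t < g x then 1 else if t <= g x then p else 0.
Proof.
by rewrite /rt_prob; case: (ltgtP t (g x)); rewrite ?mulr0 ?mulr1 ?add0r ?addr0.
Qed.

Lemma rt_prob_regressor {R : realType} {d} {T : measurableType d} (p t : R)
    (g : T -> R) :
  regressor g -> 0 <= p <= 1 -> regressor (rt_prob p t g).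
Proof.
move=> [mg _] p01; split; last first.
  move=> x; rewrite rt_probE; case: ifP => _; first by rewrite ler01 lexx.
  by case: ifP; rewrite ?lexx ?ler01.
rewrite (_ : rt_prob p t g = fun x =>
    if t < g x then 1 else if t <= g x then p else 0); last first.
  by apply/funext => x; exact: rt_probE.
apply: measurable_fun_ifT => //; first exact: measurable_fun_ltr.
by apply: measurable_fun_ifT => //; exact: measurable_fun_ler.
Qed.

(** Raising t, or lowering p at the same t, lowers the prediction probability
    everywhere; the lexicographic order on (t, - p) is total, whatever g is. *)
Lemma rt_prob_total {R : realType} {d} {T : measurableType d} (g : T -> R)
    (a b : R * R) :
  unit_square a -> unit_square b ->
  (forall x, rt_prob a.1 a.2 g x <= rt_prob b.1 b.2 g x) \/
  (forall x, rt_prob b.1 b.2 g x <= rt_prob a.1 a.2 g x).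
Proof.
case: a b => [p t] [q s] [/= /andP[p0 p1] _] [/= /andP[q0 q1] _].
have mono (p' t' q' s' : R) : 0 <= p' <= 1 -> 0 <= q' <= 1 ->
    (s' < t') || (s' == t') && (p' <= q') ->
    forall x, rt_prob p' t' g x <= rt_prob q' s' g x.
  move=> /andP[? ?] /andP[? ?] + x; rewrite !rt_probE => /orP[st|].
    case: ifPn => [/(lt_trans st) ->//|_].
    case: ifPn => [/(lt_le_trans st) ->//|_].
    by case: ifPn => // _; case: ifPn.
  by move=> /andP[/eqP -> pq]; case: ifPn => // _; case: ifPn.
have [st|st|->] := ltgtP s t.
- by left; apply: mono; rewrite ?p0 ?q0 ?st.
- by right; apply: mono; rewrite ?p0 ?q0 ?st.
- have [pq|qp] := leP p q; [left|right]; apply: mono;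
    rewrite ?p0 ?q0 ?eqxx ?pq ?(ltW qp) ?orbT//.
Qed.

(** Here and below, the predicate regressor serves for every measurable function
    with values in [0, 1]: regression functions, prediction probabilities, and
    the integrands built from them. *)
Lemma regressor_integrable {R : realType} {d} {T : measurableType d}
    (mu : probability T R) (f : T -> R) :
  regressor f -> mu.-integrable setT (EFin \o f).
Proof.
move=> [mf f01]; apply: measurable_bounded_integrable => //.
  by rewrite (le_lt_trans (probability_le1 mu measurableT))// ltry.
exists 1; split; first exact: num_real.
move=> M M1 x _ /=; have /andP[f0 f1] := f01 x.
by rewrite ger0_norm// (le_trans f1)// ltW.
Qed.

Lemma regressor_bernoulli_pmf {R : realType} {d} {T : measurableType d}
    (b : bool) (f : T -> R) :
  regressor f -> regressor (fun x => bernoulli_pmf (f x) b).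
Proof.
move=> [mf f01]; case: b; split => //=; first exact: measurable_funB.
by move=> x; have := f01 x; lra.
Qed.

Lemma regressorM {R : realType} {d} {T : measurableType d} (f g : T -> R) :
  regressor f -> regressor g -> regressor (fun x => f x * g x).
Proof.
move=> [mf f01] [mg g01]; split; first exact: measurable_funM.
move=> x; have /andP[f0 f1] := f01 x; have /andP[g0 g1] := g01 x.
by rewrite mulr_ge0//= mulr_ile1.
Qed.

(** bernoulli_pmf r b is the probability r of true or 1 - r of false, so that
    the four entries of the true confusion matrix have one formula, indexed by
    the label y and the prediction b. *)
Definition confusion_entry {R : realType} {d} {T : measurableType d}
    (mu : probability T R) (eta f : T -> R) (y b : bool) : R :=
  \int[mu]_x (bernoulli_pmf (eta x) y * bernoulli_pmf (f x) b).

Definition confusion_of {R : realType} (c : bool -> bool -> R) : 'M[R]_2 :=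
  mk_confusion (c false false) (c false true) (c true false) (c true true).

Lemma true_confusionE {R : realType} {d} {T : measurableType d}
    (mu : probability T R) (eta g : T -> R) (p t : R) :
  regressor eta -> regressor g -> 0 <= p <= 1 ->
  true_confusion mu eta (rt_classifier p t g) =
  confusion_of (confusion_entry mu eta (rt_prob p t g)).
Proof.
move=> [_ eta01] rg p01; have [_ f01] := rt_prob_regressor p t g rg p01.
have inner (x : T) (F : bool -> R) : (forall b, 0 <= F b) ->
    \int[rt_classifier p t g x]_y F y =
    rt_prob p t g x * F true + (1 - rt_prob p t g x) * F false.
  by move=> F0; rewrite /Rintegral /rt_classifier (integral_bernoulli_prob (f01 x))//.
have e0 x : 0 <= eta x by have /andP[] := eta01 x.
have e1 x : 0 <= 1 - eta x by rewrite subr_ge0; have /andP[] := eta01 x.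
rewrite /true_confusion /confusion_of /confusion_entry /=.
congr mk_confusion; apply: eq_Rintegral => x _;
  rewrite inner ?subrr ?subr0 ?mulr0 ?mulr1 ?add0r ?addr0 1?mulrC//;
  by case; rewrite ?subrr ?subr0 ?mulr0 ?mulr1.
Qed.

Lemma confusion_of_in_space {R : realType} (c : bool -> bool -> R) :
  (forall y b, 0 <= c y b) ->
  c false false + c false true + c true false + c true true = 1 ->
  confusion_space (confusion_of c).
Proof.
move=> c0 c1; have := c0 true true; have := c0 true false.
have := c0 false true; have := c0 false false => h1 h2 h3 h4.
split=> [i j|].
  by rewrite mxE; case: ifP => _; case: ifP => _; lra.
by rewrite !big_ord_recl !big_ord0 !mxE /= -c1; ring.
Qed.

Lemma norm_confusion_ofB {R : realType} (c c' : bool -> bool -> R) (e : R) :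
  0 <= e -> (forall y b, `|c y b - c' y b| <= e) ->
  `|confusion_of c - confusion_of c'| <= e.
Proof.
move=> e0 cc'; rewrite /Num.Def.normr /= mx_normrE; apply: bigmax_le => // -[i j] _.
by rewrite !mxE; case: ifP => _; case: ifP => _.
Qed.

Lemma sub_regressor_integrable {R : realType} {d} {T : measurableType d}
    (mu : probability T R) (f : T -> R) (A : set T) :
  measurable A -> regressor f -> mu.-integrable A (EFin \o f).
Proof.
by move=> mA rf; apply: integrableS (regressor_integrable mu f rf).
Qed.

Lemma Rintegral_fibers {R : realType} {d} {T : measurableType d}
    (mu : probability T R) {K : finType} (c : T -> K) (phi : K -> R)
    (w : T -> R) :
  (forall k, measurable (c @^-1` [set k])) -> regressor w ->
  \int[mu]_x (w x * phi (c x)) =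
  \sum_k phi k * \int[mu]_(x in c @^-1` [set k]) w x.
Proof.
move=> mc rw.
have iw k : mu.-integrable setT (EFin \o (w \_ (c @^-1` [set k]))).
  have := sub_regressor_integrable mu w _ (mc k) rw.
  by move/(integrable_mkcond _ (mc k)); rewrite restrict_EFin.
have ipw k : mu.-integrable setT
    (fun x => (phi k * (w \_ (c @^-1` [set k])) x)%:E).
  by have := integrableZl measurableT (phi k) (iw k); apply: eq_integrable.
transitivity (fine (\sum_k \int[mu]_x (phi k * (w \_ (c @^-1` [set k])) x)%:E)%E).
  rewrite -integral_sum//; congr fine; apply: eq_integral => x _.
  rewrite sumEFin; congr EFin; rewrite (bigD1 (c x))//= big1 => [|k /negPf ckx].
    by rewrite patchT ?inE// addr0 mulrC.
  rewrite patchN ?mulr0//; apply/negP; rewrite inE /= => cxk.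
  by rewrite cxk eqxx in ckx.
rewrite -sum_fine; last first.
  by move=> k _; exact: integrable_fin_num.
apply: eq_bigr => k _; rewrite [RHS]mulrC [in RHS]Rintegral_mkcond -RintegralZr//.
by congr fine; apply: eq_integral => x _; rewrite mulrC.
Qed.

Lemma confusion_entry_ge0 {R : realType} {d} {T : measurableType d}
    (mu : probability T R) (eta f : T -> R) (y b : bool) :
  regressor eta -> regressor f -> 0 <= confusion_entry mu eta f y b.
Proof.
move=> reta rf; apply: Rintegral_ge0 => x _.
by have [_ /(_ x) /andP[]] := regressorM _ _ (regressor_bernoulli_pmf y _ reta)
  (regressor_bernoulli_pmf b _ rf).
Qed.

Lemma confusion_entry_sum1 {R : realType} {d} {T : measurableType d}
    (mu : probability T R) (eta f : T -> R) :
  regressor eta -> regressor f ->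
  confusion_entry mu eta f false false + confusion_entry mu eta f false true +
  confusion_entry mu eta f true false + confusion_entry mu eta f true true = 1.
Proof.
move=> reta rf; have ie y b := regressor_integrable mu _
  (regressorM _ _ (regressor_bernoulli_pmf y _ reta) (regressor_bernoulli_pmf b _ rf)).
have row y : confusion_entry mu eta f y false + confusion_entry mu eta f y true =
    \int[mu]_x bernoulli_pmf (eta x) y.
  rewrite -RintegralD//.
  by apply: eq_Rintegral => x _; rewrite /bernoulli_pmf; ring.
rewrite -addrA !row -RintegralD//.
- rewrite (@eq_Rintegral _ _ _ _ _ (cst 1)); last first.
    by move=> x _; rewrite /bernoulli_pmf /=; ring.
  by rewrite Rintegral_cst// mul1r -[RHS]/(fine 1%E) -(probability_setT mu).
- exact/regressor_integrable/regressor_bernoulli_pmf.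
- exact/regressor_integrable/regressor_bernoulli_pmf.
Qed.

Lemma regressor_normB {R : realType} {d} {T : measurableType d}
    (f f' : T -> R) :
  regressor f -> regressor f' -> regressor (fun x => `|f x - f' x|).
Proof.
move=> [mf f01] [mf' f'01]; split.
  by apply: measurableT_comp => //; exact: measurable_funB.
move=> x; rewrite normr_ge0/= ler_norml.
by have := f01 x; have := f'01 x; lra.
Qed.

(** The weight bernoulli_pmf (eta x) y is at most 1, and f enters the integrand
    through f or 1 - f. *)
Lemma confusion_entry_dist {R : realType} {d} {T : measurableType d}
    (mu : probability T R) (eta f f' : T -> R) (y b : bool) :
  regressor eta -> regressor f -> regressor f' ->
  `|confusion_entry mu eta f y b - confusion_entry mu eta f' y b| <=
  \int[mu]_x `|f x - f' x|.
Proof.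
move=> reta rf rf'; have ie g (rg : regressor g) := regressor_integrable mu _
  (regressorM _ _ (regressor_bernoulli_pmf y _ reta) (regressor_bernoulli_pmf b g rg)).
rewrite -RintegralB//; [|exact: ie..].
have iB : mu.-integrable setT (EFin \o (fun x =>
    bernoulli_pmf (eta x) y * bernoulli_pmf (f x) b -
    bernoulli_pmf (eta x) y * bernoulli_pmf (f' x) b)).
  by have := integrableB measurableT (ie _ rf) (ie _ rf'); apply: eq_integrable.
apply: le_trans (le_normr_Rintegral _ _) _ => //.
apply: le_Rintegral => //; first exact: (integrable_norm iB).
  exact/regressor_integrable/regressor_normB.
move=> x _; rewrite -mulrBr normrM.
have [_ /(_ x) /andP[e0 e1]] := regressor_bernoulli_pmf y _ reta.
rewrite ger0_norm// -[leRHS]mul1r ler_pM//.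
by case: b {ie iB} => //=; rewrite opprB addrC addrA subrK distrC.
Qed.

Lemma confusion_entry_mono {R : realType} {d} {T : measurableType d}
    (mu : probability T R) (eta f f' : T -> R) (y b : bool) :
  regressor eta -> regressor f -> regressor f' -> (forall x, f x <= f' x) ->
  if b then confusion_entry mu eta f y b <= confusion_entry mu eta f' y b
  else confusion_entry mu eta f' y b <= confusion_entry mu eta f y b.
Proof.
move=> reta rf rf' ff'.
have ie b' g (rg : regressor g) := regressor_integrable mu _
  (regressorM _ _ (regressor_bernoulli_pmf y _ reta) (regressor_bernoulli_pmf b' g rg)).
have e0 x : 0 <= bernoulli_pmf (eta x) y.
  by have [_ /(_ x) /andP[]] := regressor_bernoulli_pmf y _ reta.
case: b; (apply: le_Rintegral; [by []|exact: ie|exact: ie|]).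
  by move=> x _; rewrite ler_wpM2l//= ff'.
by move=> x _; rewrite ler_wpM2l//= lerD2l lerN2 ff'.
Qed.

(** Where g x is farther than s from t, g x and g' x are on the same side of t
    and the two prediction probabilities agree. *)
Lemma rt_prob_dist {R : realType} {d} {T : measurableType d}
    (mu : probability T R) (g g' : T -> R) (p t s : R) :
  regressor g -> regressor g' -> 0 <= p <= 1 ->
  (forall x, `|g x - g' x| <= s) ->
  \int[mu]_x `|rt_prob p t g x - rt_prob p t g' x| <=
  fine (mu [set x | `|g x - t| <= s]).
Proof.
move=> rg rg' p01 gs; set A := [set x | _].
have mA : measurable A.
  rewrite (_ : A = (fun x => `|g x - t| <= s) @^-1` [set true]); last first.
    by apply/seteqP; split.
  rewrite -[X in measurable X]setTI.
  apply: measurable_fun_ler => //; apply: measurableT_comp => //.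
  by apply: measurable_funB => //; case: rg.
have -> : fine (mu A) = \int[mu]_x ((fun=> 1 : R) \_ A) x.
  by rewrite -Rintegral_mkcond Rintegral_cst// mul1r.
have rn := regressor_normB _ _ (rt_prob_regressor p t g rg p01)
  (rt_prob_regressor p t g' rg' p01).
apply: le_Rintegral => //.
- exact: regressor_integrable.
- rewrite -restrict_EFin; apply/(integrable_mkcond _ mA).
  exact: finite_measure_integrable_cst.
move=> x _; have [xA|xA] := boolP (x \in A).
  by rewrite patchT//; have [_ /(_ x) /andP[]] := rn.
rewrite patchN//; move: xA; rewrite notin_setE /A /= => /negP; rewrite -ltNge => sx.
have := gs x; rewrite ler_distl => gg'.
suff -> : rt_prob p t g x = rt_prob p t g' x by rewrite subrr normr0.
rewrite !rt_probE; move: sx; rewrite lter_normr => /orP[] sx.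
- have -> : t < g x by lra.
  by have -> : t < g' x by lra.
- have -> : t < g x = false by lra.
  have -> : t < g' x = false by lra.
  have -> : t <= g x = false by lra.
  by have -> : t <= g' x = false by lra.
Qed.

(** * Cells of the data and of the noise *)

(** Whatever x is, the prediction compares z with 0, p or 1.  Hence the position
    of g x with respect to t and that of z with respect to these three numbers
    determine the prediction; cell_predict is the resulting decision rule.  The
    bounds 0 and 1 cannot be dropped pointwise, since z ranges over all reals
    and is in [0, 1[ only almost surely. *)
Definition level_cell {R : realType} {T : Type} (t : R) (g : T -> R) (x : T) :
    bool * bool :=
  (t <= g x, t < g x).

Definition data_cell {R : realType} {T : Type} (t : R) (g : T -> R)
    (w : T * bool) : bool * (bool * bool) :=
  (w.2, level_cell t g w.1).

Definition noise_cell {R : realType} (p z : R) : (bool * bool) * bool :=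
  ((z < 0, z < p), z < 1).

Definition cell_predict (l : bool * bool) (c : (bool * bool) * bool) : bool :=
  if l.2 then c.2 else if l.1 then c.1.2 else c.1.1.

Definition cell_event (y b : bool)
    (k : (bool * (bool * bool)) * ((bool * bool) * bool)) : bool :=
  (k.1.1 == y) && (cell_predict k.1.2 k.2 == b).

Lemma cell_eventE {R : realType} {d} {T : measurableType d} (p t : R)
    (g : T -> R) (y b : bool) (w : T * bool) (z : R) :
  cell_event y b (data_cell t g w, noise_cell p z) =
  (w.2 == y) && (rt_predict p t g w.1 z == b).
Proof.
rewrite /cell_event /rt_predict rt_probE /cell_predict /=; congr (_ && (_ == _)).
by case: ifP => // _; case: ifP.
Qed.

Lemma measurable_level_cell {R : realType} {d} {T : measurableType d} (t : R)
    (g : T -> R) (l : bool * bool) :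
  measurable_fun setT g -> measurable (level_cell t g @^-1` [set l]).
Proof.
case: l => l1 l2 mg.
rewrite (_ : _ @^-1` _ =
    (fun x => t <= g x) @^-1` [set l1] `&` (fun x => t < g x) @^-1` [set l2]).
  by apply: measurableI; rewrite -[X in measurable X]setTI;
    [apply: measurable_fun_ler|apply: measurable_fun_ltr].
by apply/seteqP; split => [x [<- <-]|x [/= <- <-]].
Qed.

Lemma data_cell_fiber {R : realType} {T : Type} (t : R) (g : T -> R)
    (k : bool * (bool * bool)) :
  data_cell t g @^-1` [set k] = (level_cell t g @^-1` [set k.2]) `*` [set k.1].
Proof.
by case: k => y l; apply/seteqP; split => [[x y'] [/= -> ->]|[x y'] [/= <- ->]].
Qed.

Lemma measurable_data_cell {R : realType} {d} {T : measurableType d} (t : R)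
    (g : T -> R) (k : bool * (bool * bool)) :
  measurable_fun setT g -> measurable (data_cell t g @^-1` [set k]).
Proof.
move=> mg; rewrite data_cell_fiber; apply: measurableX => //.
exact: measurable_level_cell.
Qed.

Lemma measurable_noise_cell {R : realType} (p : R) k :
  measurable (noise_cell p @^-1` [set k]).
Proof.
case: k => [[c0 cp] c1].
have m (c : R) (l : bool) : measurable ((fun z => z < c) @^-1` [set l]).
  by rewrite -[X in measurable X]setTI; apply: measurable_fun_ltr.
rewrite (_ : _ @^-1` _ = (fun z => z < 0) @^-1` [set c0] `&`
    (fun z => z < p) @^-1` [set cp] `&` (fun z => z < 1) @^-1` [set c1]).
  by apply: measurableI => //; exact: measurableI.
by apply/seteqP; split => [z /= [-> -> ->]|z [[/= <- <-] <-]].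
Qed.

(** The defining property of a regression function concerns the label true; the
    label false follows by subtraction from the marginal. *)
Lemma regression_function_strip {R : realType} {d} {T : measurableType d}
    (PXY : probability (T * bool)%type R) (eta : T -> R) (A : set T)
    (y : bool) :
  regression_function PXY eta -> measurable A ->
  fine (PXY (A `*` [set y])) =
  \int[marginal PXY]_(x in A) bernoulli_pmf (eta x) y.
Proof.
move=> [reta etaE] mA; have etaR : fine (PXY (A `*` [set true])) =
    \int[marginal PXY]_(x in A) eta x by rewrite etaE.
case: y => //=.
have ie : (marginal PXY).-integrable A (EFin \o eta).
  exact: sub_regressor_integrable.
have i1 : (marginal PXY).-integrable A (EFin \o (fun=> 1)).
  exact: finite_measure_integrable_cst.
rewrite (RintegralB _ i1 ie)// -etaR Rintegral_cst// mul1r.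
apply/eqP; rewrite eq_sym subr_eq; apply/eqP.
have margE : marginal PXY A = (PXY (A `*` [set false] `|` A `*` [set true]))%E.
  congr (PXY _); apply/seteqP; split => [[x y] /= Ax|[x y] [] []//].
  by case: y; [right|left].
rewrite -fineD ?fin_num_measure//; try exact: measurableX.
transitivity (fine (PXY (A `*` [set false] `|` A `*` [set true]))).
  by rewrite -margE.
rewrite measureU//; try exact: measurableX.
by apply/seteqP; split => // -[x y] [[_ /= ->] [_ //]].
Qed.

(** The expectation of an empirical entry is the true entry.  Summing first over
    the noise, its law turns the decision rule into the prediction probability
    of the level; summing then over the levels gives the integral of a function
    that is constant on the fibers of level_cell. *)
Lemma cell_mass_confusion_entry {R : realType} {d} {T : measurableType d}
    (PXY : probability (T * bool)%type R)
    (nu : probability R R) (eta g : T -> R) (p t : R) (y b : bool) :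
  (forall c : R, 0 <= c <= 1 -> nu [set z | z < c] = c%:E) ->
  regression_function PXY eta -> regressor g -> 0 <= p <= 1 ->
  \sum_(k | cell_event y b k)
    cell_mass PXY nu (data_cell t g) (noise_cell p) k =
  confusion_entry (marginal PXY) eta (rt_prob p t g) y b.
Proof.
move=> nuE reta [mg _] p01.
pose thr (l : bool * bool) : R := if l.2 then 1 else if l.1 then p else 0.
have thr01 l : 0 <= thr l <= 1.
  by rewrite /thr; case: l.2; [rewrite ler01 lexx|case: l.1; rewrite ?lexx ?ler01].
have noise l : \sum_(c | cell_predict l c == b)
    fine (nu (noise_cell p @^-1` [set c])) = bernoulli_pmf (thr l) b.
  have [_ <-] := fine_measure_fibers nu (noise_cell p)
    (measurable_noise_cell p) (fun c => cell_predict l c == b).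
  have E : [set z | cell_predict l (noise_cell p z)] = [set z | z < thr l].
    by apply/seteqP; split => z /=; rewrite /cell_predict /thr;
      case: l.2 => //; case: l.1.
  case: b => /=.
    rewrite (_ : [set z | _] = [set z | z < thr l]) ?nuE//.
    by rewrite -E; apply/seteqP; split => z /= /eqP.
  rewrite (_ : [set z | _] = ~` [set z | z < thr l]).
    rewrite probability_setC ?nuE//.
    by rewrite -[X in measurable X]setTI -preimage_true; apply: measurable_fun_ltr.
  by rewrite -E; apply/seteqP; split => z /=; case: cell_predict.
transitivity (\sum_l fine (PXY ((level_cell t g @^-1` [set l]) `*` [set y])) *
    bernoulli_pmf (thr l) b).
  rewrite /cell_mass.
  rewrite -(pair_big_dep (fun k1 => k1.1 == y)
    (fun k1 k2 => cell_predict k1.2 k2 == b) (fun k1 k2 =>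
    fine (PXY (data_cell t g @^-1` [set k1])) *
    fine (nu (noise_cell p @^-1` [set k2])))) /=.
  under eq_bigr do rewrite -mulr_sumr noise data_cell_fiber.
  rewrite (eq_bigl (fun k : bool * (bool * bool) => (k.1 == y) && true));
    last by move=> k; rewrite andbT.
  rewrite -(pair_big_dep (pred1 y) (fun _ _ => true) (fun y' l =>
    fine (PXY ((level_cell t g @^-1` [set l]) `*` [set y'])) *
    bernoulli_pmf (thr l) b)) /=.
  by rewrite big_pred1_eq.
rewrite /confusion_entry.
transitivity (\int[marginal PXY]_x (bernoulli_pmf (eta x) y *
    bernoulli_pmf (thr (level_cell t g x)) b)); last first.
  by apply: eq_Rintegral => x _; rewrite rt_probE.
rewrite (Rintegral_fibers _ (level_cell t g) ((bernoulli_pmf ^~ b) \o thr))//; last 2 first.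
- by move=> l; exact: measurable_level_cell.
- by apply: regressor_bernoulli_pmf; case: reta.
by apply: eq_bigr => l _; rewrite mulrC /= (regression_function_strip _ eta)//;
  exact: measurable_level_cell.
Qed.

(** * Randomized quantiles *)

Lemma rt_prob_mean {R : realType} {d} {T : measurableType d}
    (mu : probability T R) (g : T -> R) (p t : R) :
  regressor g ->
  \int[mu]_x rt_prob p t g x =
  (1 - p) * fine (mu [set x | t < g x]) + p * fine (mu [set x | t <= g x]).
Proof.
move=> [mg _].
have ind (A : set T) : measurable A ->
    mu.-integrable setT (EFin \o ((fun=> 1 : R) \_ A)) /\
    fine (mu A) = \int[mu]_x ((fun=> 1 : R) \_ A) x.
  move=> mA; split; last by rewrite -Rintegral_mkcond Rintegral_cst// mul1r.
  rewrite -restrict_EFin; apply/(integrable_mkcond _ mA).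
  exact: finite_measure_integrable_cst.
have m1 : measurable [set x | t < g x].
  by rewrite -[X in measurable X]setTI -preimage_true; apply: measurable_fun_ltr.
have m2 : measurable [set x | t <= g x].
  by rewrite -[X in measurable X]setTI -preimage_true; apply: measurable_fun_ler.
have [i1 ->] := ind _ m1; have [i2 ->] := ind _ m2.
have iZ (c : R) f : mu.-integrable setT (EFin \o f) ->
    mu.-integrable setT (EFin \o (fun x => c * f x)).
  by move=> /(integrableZl measurableT c); apply: eq_integrable.
rewrite -!RintegralZl// -RintegralD//; [|exact: iZ..].
have patch1 (Q : pred T) x : ((fun=> 1 : R) \_ [set x | Q x]) x = (Q x)%:R.
  have [Qx|nQx] := boolP (Q x); first by rewrite patchT ?inE.
  by rewrite patchN// notin_setE /=; exact/negP.
apply: eq_Rintegral => x _; rewrite rt_probE !patch1.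
by case: (ltgtP t (g x)) => _ /=; ring.
Qed.

(** A randomized quantile: t is the infimum of the s such that {g > s} has mass
    at most v.  Right-continuity of the distribution function of g gives mass at
    most v to {g > t}, that of - g gives mass at least v to {g >= t}, and p
    interpolates between the two. *)
Lemma exists_rt_prob_mean {R : realType} {d} {T : measurableType d}
    (mu : probability T R) (g : T -> R) (v : R) :
  regressor g -> 0 <= v <= 1 ->
  exists2 a : R * R, unit_square a & \int[mu]_x rt_prob a.1 a.2 g x = v.
Proof.
move=> rg /andP[v0 v1]; have [mg g01] := rg.
have mlt t : measurable [set x | t < g x].
  by rewrite -[X in measurable X]setTI -preimage_true; apply: measurable_fun_ltr.
have mle t : measurable [set x | t <= g x].
  by rewrite -[X in measurable X]setTI -preimage_true; apply: measurable_fun_ler.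
pose S := [set t : R | 0 <= t <= 1 /\ fine (mu [set x | t < g x]) <= v].
have S1 : S 1.
  split; first by rewrite ler01 lexx.
  rewrite (_ : [set x | _] = set0) ?measure0//.
  by apply/seteqP; split => x //=; have := g01 x; lra.
have infS : has_inf S by split; [exists 1|exists 0 => t [/andP[]]].
pose t := inf S.
have t1 : t <= 1 by apply: ge_inf => //; case: infS.
have t0 : 0 <= t by apply: lb_le_inf; [exists 1|move=> s [/andP[]]].
have G : fine (mu [set x | t < g x]) <= v.
  pose X : {RV mu >-> R} := HB.pack g (isMeasurableFun.Build _ _ _ _ g mg).
  have cX s : (cdf X s = 1 - mu [set x | (s < g x)%R])%E.
    rewrite -probability_setC// /cdf; congr (mu _).
    by apply/seteqP; split => x /=; rewrite in_itv/= leNgt => /negP.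
  suff : ((1 - v)%:E <= cdf X t)%E.
    rewrite cX -[mu _]fineK ?fin_num_measure// -EFinB lee_fin; lra.
  apply: (cvge_to_ge (@cdf_right_continuous _ _ _ mu X t)).
  near=> s.
  have /(inf_lt infS.1) [r [_ Gr] rs] : t < s by near: s; exact: nbhs_right_gt.
  rewrite cX -[mu _]fineK ?fin_num_measure// -EFinB lee_fin lerD2l lerN2.
  apply: le_trans Gr; rewrite fine_le ?fin_num_measure// le_measure ?inE//.
  by move=> x /=; exact: lt_trans.
have H : v <= fine (mu [set x | t <= g x]).
  have [t00|tpos] := eqVneq t 0.
    rewrite (_ : [set x | _] = setT) ?probability_setT//.
    by apply/seteqP; split => x //= _; rewrite t00; case/andP: (g01 x).
  have tp : 0 < t by rewrite lt_neqAle eq_sym tpos.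
  have mNg : measurable_fun setT (fun x => - g x) by exact: measurableT_comp.
  pose Y : {RV mu >-> R} :=
    HB.pack (fun x => - g x) (isMeasurableFun.Build _ _ _ _ _ mNg).
  have cY s : (cdf Y s = mu [set x | (- s <= g x)%R])%E.
    rewrite /cdf; congr (mu _).
    by apply/seteqP; split => x /=; rewrite in_itv/= lerNl.
  suff : (v%:E <= cdf Y (- t))%E.
    by rewrite cY opprK -[mu _]fineK ?fin_num_measure.
  apply: (cvge_to_ge (@cdf_right_continuous _ _ _ mu Y (- t))).
  near=> s.
  have ts : - t < s by near: s; exact: nbhs_right_gt.
  have s0 : s < 0 by near: s; apply: nbhs_right_lt; lra.
  have nS : ~ S (- s).
    by move=> Ss; have := ge_inf infS.2 Ss; rewrite -/t; lra.
  rewrite cY -[mu _]fineK ?fin_num_measure// lee_fin.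
  have vG : v < fine (mu [set x | - s < g x]).
    by rewrite ltNge; apply/negP => Gs; apply: nS; split => //; lra.
  apply: le_trans (ltW vG) _; rewrite fine_le ?fin_num_measure// le_measure ?inE//.
  by move=> x /=; exact: ltW.
set a := fine (mu [set x | t < g x]) in G.
set b := fine (mu [set x | t <= g x]) in H.
exists (if a == b then 0 else (v - a) / (b - a), t).
  split => /=; last by rewrite t0 t1.
  case: eqVneq => [_|ab]; first by rewrite lexx ler01.
  have ab' : 0 < b - a by rewrite subr_gt0 lt_neqAle ab; lra.
  by rewrite divr_ge0 ?ler_pdivrMr//=; lra.
rewrite rt_prob_mean//= -/a -/b; case: eqVneq => [ab|ab]; first lra.
by field; rewrite subr_eq0 eq_sym.
Unshelve. all: by end_near.
Qed.

(** * Deviation on finitely many thresholds *)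

Lemma measure_finType_union_le {R : realType} {d} {T : measurableType d}
    (mu : probability T R) {I : finType} (F : I -> set T) (e : R) :
  (forall i, measurable (F i)) -> (forall i, (mu (F i) <= e%:E)%E) ->
  (mu (\bigcup_i F i) <= (#|I|%:R * e)%:E)%E.
Proof.
move=> mF Fe; have -> : \bigcup_i F i = \big[setU/set0]_(i <- enum I) F i.
  rewrite -bigcup_seq; congr bigcup; apply/seteqP; split => i //= _.
  by rewrite mem_enum.
rewrite cardE; elim: (enum I) => [|i s IHs].
  by rewrite big_nil measure0 mul0r.
rewrite big_cons (le_trans (measureU2 _ _ _))//.
  exact: bigsetU_measurable.
by rewrite /= -natr1 mulrDl mul1r addrC EFinD leeD.
Qed.

(** The empirical analogue of confusion_entry; the prediction at a sample point
    is z < f x, so that f = rt_prob p t g gives rt_predict. *)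
Definition empirical_entry {R : realType} {T : Type} {n : nat} (w : 'I_n -> T * bool)
    (f : T -> R) (z : 'I_n -> R) (y b : bool) : R :=
  n%:R^-1 * \sum_i (((w i).2 == y) && ((z i < f (w i).1) == b))%:R.

Lemma empirical_confusionE {R : realType} {T : Type} {n : nat}
    (w : 'I_n -> T * bool) (f : T -> R) (z : 'I_n -> R) :
  empirical_confusion R (fun i => (w i).2) (fun i => z i < f (w i).1) =
  confusion_of (empirical_entry w f z).
Proof.
by congr mk_confusion; congr (_ * _); apply: eq_bigr => i _;
  case: (w i).2; case: (_ < _); rewrite /= ?subrr ?subr0 ?mulr0 ?mul0r ?mulr1.
Qed.

Lemma empirical_entry_ge0 {R : realType} {T : Type} {n : nat}
    (w : 'I_n -> T * bool) (f : T -> R) (z : 'I_n -> R) (y b : bool) :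
  0 <= empirical_entry w f z y b.
Proof. by rewrite mulr_ge0 ?invr_ge0// sumr_ge0. Qed.

Lemma empirical_entry_sum1 {R : realType} {T : Type} {n : nat}
    (w : 'I_n -> T * bool) (f : T -> R) (z : 'I_n -> R) :
  (0 < n)%N ->
  empirical_entry w f z false false + empirical_entry w f z false true +
  empirical_entry w f z true false + empirical_entry w f z true true = 1.
Proof.
move=> n0; rewrite -!mulrDr -!big_split /= (eq_bigr (fun=> 1)).
  by rewrite sumr_const card_ord mulVf// pnatr_eq0 -lt0n.
by move=> i _; case: (w i).2; case: (_ < _); rewrite /= ?addr0 ?add0r.
Qed.

Lemma empirical_entry_mono {R : realType} {T : Type} {n : nat}
    (w : 'I_n -> T * bool) (f f' : T -> R) (z : 'I_n -> R) (y b : bool) :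
  (forall x, f x <= f' x) ->
  if b then empirical_entry w f z y b <= empirical_entry w f' z y b
  else empirical_entry w f' z y b <= empirical_entry w f z y b.
Proof.
move=> ff'.
have zf i : (z i < f (w i).1) ==> (z i < f' (w i).1).
  by apply/implyP => /lt_le_trans; exact.
by case: b; rewrite ler_wpM2l ?invr_ge0//; apply: ler_sum => i _;
  rewrite ler_nat; move: (zf i); do 2 case: (_ < _) => //=; case: (_ == y).
Qed.

(** A union bound over m thresholds, four entries and two tails.  The lower tail
    of a count is the upper tail of the complementary count, hence the boolean
    that selects a cell event or its negation. *)
Lemma grid_deviation {R : realType} {d} {T : measurableType d}
    (PXY : probability (T * bool)%type R) (nu : probability R R)
    {d'} {Omega : measurableType d'} (P : probability Omega R) (n m : nat)
    (W : 'I_n -> {RV P >-> (T * bool)%type}) (Z : 'I_n -> {RV P >-> R})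
    (eta g : T -> R) (theta : 'I_m -> R * R) (u : R) :
  (0 < n)%N -> iid W PXY -> iid Z nu -> independent_families W Z ->
  (forall c : R, 0 <= c <= 1 -> nu [set z | z < c] = c%:E) ->
  regression_function PXY eta -> regressor g ->
  (forall j, unit_square (theta j)) -> 0 <= u <= 2^-1 ->
  exists2 A : set Omega, measurable A /\
    ((1 - (8 * m)%:R * expR (- (n%:R * u ^+ 2 / 2)))%:E <= P A)%E &
    forall w, A w -> forall j y b,
      let f := rt_prob (theta j).1 (theta j).2 g in
      `|empirical_entry (W ^~ w) f (Z ^~ w) y b -
        confusion_entry (marginal PXY) eta f y b| <= u.
Proof.
move=> n0 iW iZ iWZ nuE reta rg th01 u01.
pose a j := data_cell (theta j).2 g : T * bool -> _.
pose c j := noise_cell (theta j).1.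
pose h (k : 'I_m * (bool * bool) * bool) cell :=
  if k.2 then cell_event k.1.2.1 k.1.2.2 cell
  else ~~ cell_event k.1.2.1 k.1.2.2 cell.
pose q (k : 'I_m * (bool * bool) * bool) :=
  cell_mass PXY nu (a k.1.1) (c k.1.1).
pose E k := [set w | n%:R * (\sum_(x | h k x) q k x + u) <
  \sum_i (h k (a k.1.1 (W i w), c k.1.1 (Z i w)))%:R].
have ma j x : measurable (a j @^-1` [set x]).
  by apply: measurable_data_cell; case: rg.
have mc j x : measurable (c j @^-1` [set x]) by exact: measurable_noise_cell.
have PE k := iid_cells_tail P n W Z PXY nu (a k.1.1) (c k.1.1) (h k) u
  n0 iW iZ iWZ (ma k.1.1) (mc k.1.1) u01.
have mE k : measurable (E k) by case: (PE k).
have mU : measurable (\bigcup_k E k).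
  by apply: fin_bigcup_measurable => //; exact: finite_finset.
exists (~` \bigcup_k E k); first split; first exact: measurableC.
  rewrite probability_setC// EFinB leeB//.
  have -> : (8 * m)%:R = #|{: 'I_m * (bool * bool) * bool}|%:R :> R.
    by rewrite !card_prod !card_bool card_ord; congr _%:R; ring.
  by apply: measure_finType_union_le => // k; case: (PE k).
move=> w nE j y b; cbv zeta; set f := rt_prob _ _ _.
have tail s : \sum_i (h (j, (y, b), s) (a j (W i w), c j (Z i w)))%:R <=
    n%:R * (\sum_(x | h (j, (y, b), s) x) q (j, (y, b), s) x + u).
  by rewrite leNgt; apply/negP => Ew; apply: nE; exists (j, (y, b), s).
have pE : \sum_(x | cell_event y b x) cell_mass PXY nu (a j) (c j) x =
    confusion_entry (marginal PXY) eta f y b.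
  by apply: cell_mass_confusion_entry => //; case: (th01 j).
have n0R : 0 < n%:R :> R by rewrite ltr0n.
have := tail true; have := tail false; rewrite /h /q /= pE.
have := cell_mass_sum1 PXY nu (a j) (c j) (ma j) (mc j).
rewrite (bigID (cell_event y b)) /= pE => /(canRL (addKr _)) ->.
set p := confusion_entry _ _ _ _ _.
set S := \sum_i (cell_event y b _)%:R.
have -> : \sum_i (~~ cell_event y b (a j (W i w), c j (Z i w)))%:R = n%:R - S.
  rewrite -[n in n%:R]card_ord -sumr_const -sumrB; apply: eq_bigr => i _.
  by case: cell_event; rewrite ?subrr ?subr0.
have -> : empirical_entry (W ^~ w) f (Z ^~ w) y b = n%:R^-1 * S.
  congr (_ * _); apply: eq_bigr => i _; rewrite /a /c cell_eventE.
  by rewrite /rt_predict.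
move=> lo hi; rewrite ler_distl ler_pdivlMl// ler_pdivrMl//.
apply/andP; split; first lra.
by [].
Qed.

(** * Bracketing all thresholds by a grid *)

(** The two end points are not left to exists_rt_prob_mean: their functions must
    be 0 and 1 everywhere, not only in mean, for the grid to bracket every
    threshold. *)
Lemma rt_prob_grid {R : realType} {d} {T : measurableType d}
    (mu : probability T R) (g : T -> R) (k : nat) :
  regressor g -> (0 < k)%N ->
  exists theta : nat -> R * R,
    [/\ forall j, unit_square (theta j),
        forall x, rt_prob (theta 0%N).1 (theta 0%N).2 g x = 0,
        forall x, rt_prob (theta k).1 (theta k).2 g x = 1 &
        forall j, (j <= k)%N ->
          \int[mu]_x rt_prob (theta j).1 (theta j).2 g x = j%:R / k%:R].
Proof.
move=> rg k0; have [_ g01] := rg; have kR : 0 < k%:R :> R by rewrite ltr0n.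
have /choice [q qP] (j : nat) : exists a : R * R, unit_square a /\
    \int[mu]_x rt_prob a.1 a.2 g x = (minn j k)%:R / k%:R.
  have [|a ua ma] := exists_rt_prob_mean mu g ((minn j k)%:R / k%:R) rg.
    by rewrite divr_ge0//= ler_pdivrMr// mul1r ler_nat geq_minr.
  by exists a.
have f0 x : rt_prob 0 1 g x = 0.
  by rewrite rt_probE; have /andP[_ /le_gtF ->] := g01 x; case: ifP.
have f1 x : rt_prob 1 0 g x = 1.
  by rewrite rt_probE; have /andP[-> _] := g01 x; case: ifP.
exists (fun j => if j == 0%N then (0, 1) else if j == k then (1, 0) else q j).
split=> [j|x|x|j jk] //=.
- case: ifP => _; first by split; rewrite /= ?lexx ?ler01.
  by case: ifP => _; [split; rewrite /= ?lexx ?ler01|case: (qP j)].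
- by rewrite -(negbK (k == 0%N)) -lt0n k0 eqxx /= f1.
- have [->|j0] := eqVneq j 0%N.
    by rewrite mul0r /= (@eq_Rintegral _ _ _ _ _ (cst 0)) ?Rintegral_cst// ?mul0r.
  have [->|jnk] := eqVneq j k; last by have [_ ->] := qP j; rewrite (minn_idPl jk).
  rewrite /= (@eq_Rintegral _ _ _ _ _ (cst 1)) ?Rintegral_cst//.
  rewrite mul1r divff ?gt_eqF// -[RHS]/(fine 1%E) -(probability_setT mu)//.
Qed.

(** Walk up the grid as long as it stays below the given function; by totality,
    the first grid function that is not below it is above it. *)
Lemma rt_prob_bracket {R : realType} {d} {T : measurableType d} (g : T -> R)
    (k : nat) (theta : nat -> R * R) (a : R * R) :
  (0 < k)%N -> (forall j, unit_square (theta j)) ->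
  (forall x, rt_prob (theta 0%N).1 (theta 0%N).2 g x = 0) ->
  (forall x, rt_prob (theta k).1 (theta k).2 g x = 1) ->
  unit_square a -> (forall x, 0 <= rt_prob a.1 a.2 g x <= 1) ->
  exists2 j, (j < k)%N & forall x,
    rt_prob (theta j).1 (theta j).2 g x <= rt_prob a.1 a.2 g x
      <= rt_prob (theta j.+1).1 (theta j.+1).2 g x.
Proof.
move=> k0 th01 th0 thk ua f01.
pose f j x := rt_prob (theta j).1 (theta j).2 g x.
have H m : (m < k)%N -> (exists2 j, (j < k)%N & forall x,
      f j x <= rt_prob a.1 a.2 g x <= f j.+1 x) \/
    (forall x, f m x <= rt_prob a.1 a.2 g x).
  elim: m => [_|m IHm mk].
    by right => x; rewrite /f th0; case/andP: (f01 x).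
  have [|jP|fm] := IHm; [exact: ltnW|by left|].
  have [am|ma] := rt_prob_total g a (theta m.+1) ua (th01 _); last by right.
  left; exists m; first exact: ltnW.
  by move=> x; rewrite fm am.
have [|//|fk] := H k.-1; first by rewrite prednK.
exists k.-1; rewrite prednK// => x; rewrite fk thk.
by case/andP: (f01 x).
Qed.

(** Both entries of f lie between those of its two grid neighbours, and the true
    entries of the neighbours differ by at most the difference 1/k of their
    means. *)
Lemma bracketed_deviation {R : realType} {d} {T : measurableType d}
    (mu : probability T R) (eta g : T -> R) (k n : nat)
    (theta : nat -> R * R) (w : 'I_n -> T * bool) (z : 'I_n -> R) (u : R) :
  (0 < k)%N -> regressor eta -> regressor g ->
  (forall j, unit_square (theta j)) ->
  (forall x, rt_prob (theta 0%N).1 (theta 0%N).2 g x = 0) ->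
  (forall x, rt_prob (theta k).1 (theta k).2 g x = 1) ->
  (forall j, (j <= k)%N ->
    \int[mu]_x rt_prob (theta j).1 (theta j).2 g x = j%:R / k%:R) ->
  (forall j, (j <= k)%N -> forall y b,
    let f := rt_prob (theta j).1 (theta j).2 g in
    `|empirical_entry w f z y b - confusion_entry mu eta f y b| <= u) ->
  forall a, unit_square a -> forall y b, let f := rt_prob a.1 a.2 g in
    `|empirical_entry w f z y b - confusion_entry mu eta f y b| <= u + k%:R^-1.
Proof.
move=> k0 reta rg th01 th0 thk thm dev a ua y b; cbv zeta.
have rf c : unit_square c -> regressor (rt_prob c.1 c.2 g).
  by move=> [c01 _]; exact: rt_prob_regressor.
have [_ fa01] := rf _ ua.
have [j jk fj] := rt_prob_bracket g k theta a k0 th01 th0 thk ua fa01.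
set f := rt_prob a.1 a.2 g in fj *.
set l := rt_prob (theta j).1 (theta j).2 g in fj.
set r := rt_prob (theta j.+1).1 (theta j.+1).2 g in fj.
have rl : regressor l by exact: rf. have rr : regressor r by exact: rf.
have rff : regressor f by exact: rf.
have lf x : l x <= f x by case/andP: (fj x).
have fr x : f x <= r x by case/andP: (fj x).
have step : `|confusion_entry mu eta r y b - confusion_entry mu eta l y b| <=
    k%:R^-1.
  apply: le_trans (confusion_entry_dist mu eta r l y b reta rr rl) _.
  rewrite (@eq_Rintegral _ _ _ _ _ (fun x => r x - l x)); last first.
    by move=> x _; rewrite ger0_norm// subr_ge0 (le_trans (lf x)).
  rewrite RintegralB//; [|exact: regressor_integrable..].
  by rewrite !thm// ?(ltnW jk)// -mulrBl -natrB// subSnn mul1r.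
have devl := dev j (ltnW jk) y b; have devr := dev j.+1 jk y b.
have el := empirical_entry_mono w l f z y b lf.
have er := empirical_entry_mono w f r z y b fr.
have cl := confusion_entry_mono mu eta l f y b reta rl rff lf.
have cr := confusion_entry_mono mu eta f r y b reta rff rr fr.
move: step devl devr; rewrite /= -/l -/r !ler_distl.
by case: b el er cl cr => el er cl cr /andP[s1 s2] /andP[l1 l2] /andP[r1 r2];
  apply/andP; split; lra.
Qed.

(** * Uniform deviation *)

Lemma uniform_prob_lt {R : realType} (c : R) :
  0 <= c <= 1 -> uniform_prob (@ltr01 R) [set z | z < c] = c%:E.
Proof.
move=> /andP[c0 c1]; rewrite /uniform_prob integral_uniform_pdf.
rewrite (_ : _ `&` _ = `[0, c[%classic); last first.
  apply/seteqP; split => z /=; rewrite !in_itv/=.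
    by move=> [zc /andP[-> _]].
  by move=> /andP[z0 zc]; split => //; rewrite z0/= ltW// (lt_le_trans zc).
rewrite (eq_integral (cst 1%:E)); last first.
  move=> z; rewrite inE/= in_itv/= => /andP[z0 zc].
  by rewrite /uniform_pdf z0 (ltW (lt_le_trans zc c1)) /= subr0 invr1.
rewrite integral_cst//= mul1e lebesgue_measure_itv/= lte_fin.
by case: ltgtP c0 => // [_ _|<- _]; rewrite ?oppr0 ?adde0// ?sube0.
Qed.

(** With e the bound and a the argument of the logarithm, n (e/2)^2 / 2 = ln a.
    The tails on a grid of n + 1 points at deviation e/2 thus sum to at most
    8 (n + 1) / a = 8 (n + 1) delta / (32 (2n + 1)) <= delta, and 1/n <= e/2
    because ln a >= 1/2. *)
Lemma uniform_deviation {R : realType} {d} {T : measurableType d}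
    (PXY : probability (T * bool)%type R)
    {d'} {Omega : measurableType d'} (P : probability Omega R) (n : nat)
    (W : 'I_n -> {RV P >-> (T * bool)%type}) (Z : 'I_n -> {RV P >-> R})
    (eta g : T -> R) (delta : R) :
  (0 < n)%N -> iid W PXY -> iid Z (uniform_prob (@ltr01 R)) ->
  independent_families W Z -> 0 < delta < 1 ->
  regression_function PXY eta -> regressor g ->
  exists A : set Omega, [/\ measurable A, ((1 - delta)%:E <= P A)%E &
    forall w, A w -> forall a, unit_square a -> forall y b,
      let f := rt_prob a.1 a.2 g in
      `|empirical_entry (W ^~ w) f (Z ^~ w) y b -
        confusion_entry (marginal PXY) eta f y b| <=
      Num.sqrt (8 / n%:R * ln (32 * (2 * n%:R + 1) / delta))].
Proof.
move=> n0 iW iZ iWZ /andP[d0 d1] reta rg; set e := Num.sqrt _.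
have nR : 1 <= n%:R :> R by rewrite ler1n.
set a := 32 * (2 * n%:R + 1) / delta in e *.
have a2 : 2 <= a by rewrite ler_pdivlMr//; lra.
have a0 : 0 < a by lra.
have la : 2^-1 <= ln a.
  have ai : a^-1 <= 2^-1 by rewrite lef_pV2 ?posrE.
  have := @le_ln1Dx R (a^-1 - 1); rewrite [1 + _]addrC subrK lnV ?posrE//.
  have : 0 < a^-1 by rewrite invr_gt0.
  by move=> ai0 /(_ _); lra.
have e2 : e ^+ 2 = 8 / n%:R * ln a.
  by rewrite sqr_sqrtr// mulr_ge0 ?divr_ge0//; lra.
have e0 : 0 <= e by exact: sqrtr_ge0.
(* The Chernoff bound needs e/2 <= 1/2; beyond, the claim is that two numbers
   of [0, 1] differ by at most 1. *)
have [e1|e1] := leP 1 e.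
  exists setT; split => //; first by rewrite probability_setT lee_fin; lra.
  move=> w _ [p t] [/= p01 _] y b; apply: le_trans e1.
  set f := rt_prob p t g.
  have rf : regressor f by exact: rt_prob_regressor.
  have [rreta _] := reta.
  have c0 := confusion_entry_ge0 (marginal PXY) eta f _ _ rreta rf.
  have c1 := confusion_entry_sum1 (marginal PXY) eta f rreta rf.
  have m0 := empirical_entry_ge0 (W ^~ w) f (Z ^~ w).
  have m1 := empirical_entry_sum1 (W ^~ w) f (Z ^~ w) n0.
  have le1 (c : bool -> bool -> R) : (forall y b, 0 <= c y b) ->
    c false false + c false true + c true false + c true true = 1 ->
    c y b <= 1.
    move=> + <- => h; have := h true true; have := h true false.
    by have := h false true; have := h false false; case: y; case: b; lra.
  have := le1 _ c0 c1; have := le1 _ m0 m1; have := c0 y b; have := m0 y b.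
  by rewrite ler_norml; lra.
have [theta [th01 th0 th1 thm]] := rt_prob_grid (marginal PXY) g n rg n0.
pose i0 : 'I_n := Ordinal n0.
have iZ' : iid Z (distribution P (Z i0)).
  by case: iZ => indZ lawZ; split => // i A mA; rewrite !lawZ.
have nuE (c : R) : 0 <= c <= 1 -> distribution P (Z i0) [set z | z < c] = c%:E.
  move=> c01; case: iZ => _ -> //; first exact: uniform_prob_lt.
  by rewrite -[X in measurable X]setTI -preimage_true; apply: measurable_fun_ltr.
have [|A [mA PA] dev] := grid_deviation PXY _ P n n.+1 W Z eta g
    (fun j : 'I_n.+1 => theta j) (e / 2) n0 iW iZ' iWZ nuE reta rg
    (fun j => th01 j).
  by lra.
exists A; split => //.
  apply: le_trans PA; rewrite lee_fin lerD2l lerN2.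
  have -> : n%:R * (e / 2) ^+ 2 / 2 = ln a.
    rewrite expr_div_n e2; field; lra.
  rewrite expRN lnK ?posrE// /a invf_div mulrA ler_pdivrMr; last lra.
  by rewrite mulrC ler_wpM2l ?(ltW d0)// natrM -natr1; lra.
move=> w Aw c uc y b; cbv zeta.
apply: le_trans (bracketed_deviation (marginal PXY) eta g n n theta
  (W ^~ w) (Z ^~ w) (e / 2) n0 reta.1 rg th01 th0 th1 thm _ c uc y b) _.
  move=> j jn y' b'; have := dev w Aw (@Ordinal n.+1 j jn) y' b'; exact.
suff : n%:R^-1 <= e / 2 by lra.
rewrite -(@ler_pXn2r _ 2) ?nnegrE ?invr_ge0//; [|lra].
have n1 : n%:R^-1 <= 1 :> R by rewrite invf_le1// ltr0n.
have -> : (e / 2) ^+ 2 = n%:R^-1 * (2 * ln a) by rewrite expr_div_n e2; field; lra.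
by rewrite expr2 ler_wpM2l ?invr_ge0//; lra.
Qed.

(** * Excess risk *)

(** The matrices with TN = 1 and with TP = 1 are at positive distance. *)
Lemma lipschitz_confusion_ge0 {R : realType} (M : 'M[R]_2 -> R) (L : R) :
  L.-lipschitz_(@confusion_space R) M -> 0 <= L.
Proof.
move=> hL; pose c (y b : bool) : R := (~~ y && ~~ b)%:R.
pose c' (y b : bool) : R := (y && b)%:R.
have sc : confusion_space (confusion_of c).
  by apply: confusion_of_in_space; rewrite // /c /= !addr0.
have sc' : confusion_space (confusion_of c').
  by apply: confusion_of_in_space; rewrite // /c' /= !add0r.
have cc' : 0 < `|confusion_of c - confusion_of c'|.
  rewrite normr_gt0 subr_eq0; apply/eqP => /matrixP /(_ 0 0).
  by rewrite !mxE /= => /eqP; rewrite oner_eq0.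
have := hL (confusion_of c, confusion_of c') (conj sc sc').
by move=> /(le_trans (normr_ge0 _)); rewrite pmulr_lge0.
Qed.

Lemma lipschitz_confusion_le {R : realType} (M : 'M[R]_2 -> R) (L e : R)
    (c c' : bool -> bool -> R) :
  L.-lipschitz_(@confusion_space R) M ->
  confusion_space (confusion_of c) -> confusion_space (confusion_of c') ->
  0 <= e -> (forall y b, `|c y b - c' y b| <= e) ->
  M (confusion_of c) - M (confusion_of c') <= L * e.
Proof.
move=> hL sc sc' e0 cc'; apply: le_trans (ler_norm _) _.
have := hL (confusion_of c, confusion_of c') (conj sc sc').
move=> /le_trans; apply; rewrite ler_wpM2l ?(lipschitz_confusion_ge0 _ _ hL)//.
exact: norm_confusion_ofB.
Qed.

Lemma sup_dist_ge {R : realType} {d} {T : measurableType d} (f g : T -> R) :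
  regressor f -> regressor g -> forall x, `|f x - g x| <= sup_dist f g.
Proof.
move=> [_ f01] [_ g01] x; apply: ub_le_sup; last by exists x.
by exists 1 => _ [y _ <-]; rewrite ler_norml; have := f01 y; have := g01 y; lra.
Qed.

(** Thresholding eta or etahat at the same t differs only where eta is within
    sup_dist eta etahat of t.  The margin condition is about positive radii
    only; at radius 0 the two functions coincide. *)
Lemma margin_confusion_entry {R : realType} {d} {T : measurableType d}
    (mu : probability T R) (eta etahat : T -> R) (p t C beta : R) :
  regressor eta -> regressor etahat -> 0 <= p <= 1 ->
  margin_condition mu eta C beta t ->
  forall y b, `|confusion_entry mu eta (rt_prob p t eta) y b -
    confusion_entry mu eta (rt_prob p t etahat) y b| <=
    C * sup_dist eta etahat `^ beta.
Proof.
move=> reta rhat p01 [C0 _ _ hC] y b.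
have [mt _] := reta.
have es := sup_dist_ge _ _ reta rhat.
set s := sup_dist _ _ in es *.
have : 0 <= s by exact: le_trans (es point).
rewrite le_eqVlt => /orP[/eqP s0|s0].
  have -> : eta = etahat.
    apply/funext => x; apply/eqP; rewrite -subr_eq0 -normr_le0.
    by rewrite s0 es.
  by rewrite subrr normr0 mulr_ge0 ?powR_ge0.
apply: le_trans (confusion_entry_dist mu eta _ _ y b reta
  (rt_prob_regressor p t eta reta p01) (rt_prob_regressor p t etahat rhat p01)) _.
apply: le_trans (rt_prob_dist mu eta etahat p t s reta rhat p01 es) _.
rewrite -lee_fin fineK ?hC// fin_num_measure//.
rewrite -[X in measurable X]setTI -preimage_true; apply: measurable_fun_ler => //.
by apply: measurableT_comp => //; exact: measurable_funB.
Qed.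

Theorem corollary8 (R : realType) (X : pmetricType R) (hX : separable X)
    (PXY : probability (borel X * bool)%type R)
    (d : measure_display) (Omega : measurableType d)
    (P : probability Omega R)
    (n : nat) (hn : (0 < n)%N)
    (W : 'I_n -> {RV P >-> (borel X * bool)%type})
    (Z : 'I_n -> {RV P >-> R})
    (hS : iid W PXY)
    (hZ : iid Z (uniform_prob (@ltr01 R)))
    (hSZ : independent_families W Z)
    (delta : R) (hdelta : 0 < delta < 1)
    (eta : borel X -> R) (heta : regression_function PXY eta)
    (etahat : borel X -> R) (hetahat : regressor etahat)
    (M : 'M[R]_2 -> R) (hM : cmm M)
    (L : R) (hL : L.-lipschitz_(@confusion_space R) M)
    (phat that : Omega -> R)
    (hhat : forall omega : Omega,
      argmax_on (@unit_square R)
        (fun pt => M (empirical_confusion R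
           (fun i => (W i omega).2)
           (fun i => rt_predict pt.1 pt.2 etahat (W i omega).1 (Z i omega))))
        (phat omega, that omega))
    (pstar tstar : R)
    (hstar : argmax_on (@unit_square R)
      (fun pt => M (true_confusion (marginal PXY) eta
                      (rt_classifier pt.1 pt.2 eta)))
      (pstar, tstar))
    (C beta : R) (hmargin : margin_condition (marginal PXY) eta C beta tstar) :
  with_probability_at_least P (1 - delta)
    [set omega |
      M (true_confusion (marginal PXY) eta (rt_classifier pstar tstar eta)) -
      M (true_confusion (marginal PXY) eta
           (rt_classifier (phat omega) (that omega) etahat))
      <= L * (C * sup_dist eta etahat `^ beta +
              2 * Num.sqrt (8 / n%:R *
                            ln (32 * (2 * n%:R + 1) / delta)))].
Proof.
have reta := heta.1.
have [A [mA PA dev]] := uniform_deviation PXY P n W Z eta etahat delta hn hS hZ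
  hSZ hdelta heta hetahat.
exists A; split => // w Aw /=.
set e := Num.sqrt _ in dev *.
have e0 : 0 <= e by exact: sqrtr_ge0.
have [[/= /andP[ps0 ps1] ts01] _] := hstar.
have ps01 : 0 <= pstar <= 1 by rewrite ps0.
have [uhat maxhat] := hhat w; have [ph01 th01] := uhat.
have ustar : unit_square (pstar, tstar) by [].
pose c a g := confusion_entry (marginal PXY) eta (rt_prob a.1 a.2 g).
pose m (a : R * R) := empirical_entry (W ^~ w) (rt_prob a.1 a.2 etahat) (Z ^~ w).
have sc a g : unit_square a -> regressor g ->
    confusion_space (confusion_of (c a g)).
  move=> [a01 _] rg; have rf := rt_prob_regressor a.1 a.2 g rg a01.
  by apply: confusion_of_in_space => [y b|];
    [exact: confusion_entry_ge0|exact: confusion_entry_sum1].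
have sm a : confusion_space (confusion_of (m a)).
  by apply: confusion_of_in_space => [y b|];
    [exact: empirical_entry_ge0|exact: empirical_entry_sum1].
rewrite !true_confusionE//.
have margin := margin_confusion_entry (marginal PXY) eta etahat pstar tstar
  C beta reta hetahat ps01 hmargin.
have C0 : 0 <= C * sup_dist eta etahat `^ beta.
  by case: hmargin => ? _ _ _; rewrite mulr_ge0 ?powR_ge0.
have s1 := lipschitz_confusion_le M L _ (c (pstar, tstar) eta)
  (c (pstar, tstar) etahat) hL (sc _ _ ustar reta) (sc _ _ ustar hetahat)
  C0 margin.
have s2 := lipschitz_confusion_le M L e (c (pstar, tstar) etahat)
  (m (pstar, tstar)) hL (sc _ _ ustar hetahat) (sm _) e0.
have s4 := lipschitz_confusion_le M L e (m (phat w, that w))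
  (c (phat w, that w) etahat) hL (sm _) (sc _ _ uhat hetahat) e0
  (dev w Aw _ uhat).
have {}s2 : M (confusion_of (c (pstar, tstar) etahat)) -
    M (confusion_of (m (pstar, tstar))) <= L * e.
  by apply: s2 => y b; rewrite distrC; exact: dev.
have s3 : M (confusion_of (m (pstar, tstar))) <=
    M (confusion_of (m (phat w, that w))).
  by have := maxhat _ ustar; rewrite /rt_predict !empirical_confusionE.
rewrite -/(c (pstar, tstar) eta) -/(c (phat w, that w) etahat).
rewrite mulrDr [L * (2 * e)](_ : _ = L * e + L * e); last by ring.
lra.
Qed.
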